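(* Let $n\geq 3$, $j\in\{2,\dots,n-1\}$, $p\in[0,1)$ and $\lambda\in(0,1)$. Then there exist origin-symmetric convex bodies $K$ and $L$ in $\mathbb R^n$ such that $$V_j\big((1-\lambda)\cdot K+_p\lambda\cdot L\big)<V_j(K)^{1-\lambda}V_j(L)^{\lambda}\leq \Big((1-\lambda)V_j(K)^{p/j}+\lambda V_j(L)^{p/j}\Big)^{j/p},$$ where for $p=0$ the right-most expression is understood as $V_j(K)^{1-\lambda}V_j(L)^\lambda$.
   Context: A convex body is a compact convex subset of $\mathbb R^n$ with nonempty interior; it is (origin-)symmetric if $K=-K$. The support function is $h_K(x)=\max_{y\in K}\langle x,y\rangle$. For a continuous $f:\mathbb S^{n-1}\to(0,\infty)$, its Wulff shape $W(f)$ is the largest convex body whose support function is $\le f$ on $\mathbb S^{n-1}$. For convex bodies $K,L$ containing the origin in their interior, $\lambda\in(0,1)$, the $L_p$-Minkowski combination is $(1-\lambda)\cdot K+_p\lambda\cdot L:=W\big(((1-\lambda)h_K^p+\lambda h_L^p)^{1/p}\big)$ for $p\neq 0$ and $W(h_K^{1-\lambda}h_L^\lambda)$ for $p=0$. The intrinsic volumes $V_0(K),\dots,V_n(K)$ are defined by the Steiner formula $V_n(K+\rho B_2^n)=\sum_{j=0}^n\rho^{n-j}\kappa_{n-j}V_j(K)$ for $\rho>0$, where $V_n$ is volume, $B_2^n$ the Euclidean unit ball and $\kappa_d$ the volume of the $d$-dimensional unit ball. *)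

(* Defs.v *)
From HB Require Import structures.
From mathcomp Require Import all_boot all_order all_algebra.
From mathcomp Require Import all_classical all_reals all_analysis.
From Stdlib Require Import ClassicalEpsilon.
Set Implicit Arguments. Unset Strict Implicit. Unset Printing Implicit Defensive.
Import Order.TTheory GRing.Theory Num.Theory.
Import numFieldNormedType.Exports.
Local Open Scope classical_set_scope.
Local Open Scope ring_scope.

Section ConvexGeometry.
Variable R : realType.

Definition dotv (n : nat) (x y : 'rV[R]_n) : R := \sum_(i < n) x 0 i * y 0 i.

Definition unit_ball (n : nat) : set 'rV[R]_n := [set x | dotv x x <= 1].
Definition unit_sphere (n : nat) : set 'rV[R]_n := [set u | dotv u u = 1].

(* n-dimensional Lebesgue measure, defined as an iterated Lebesgue integral
   (Tonelli): vol_0 A = 1 iff the unique point of R^0 is in A,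
   vol_{m+1} A = \int_R vol_m (section of A at first coordinate t) dt. *)
Fixpoint volume (n : nat) : set 'rV[R]_n -> \bar R :=
  match n return set 'rV[R]_n -> \bar R with
  | 0 => fun A => if `[< A 0 >] then 1%E else 0%E
  | m.+1 => fun A =>
      (\int[@lebesgue_measure R]_(t in [set: R])
          volume [set y : 'rV[R]_m | A (row_mx (\row_(k < 1) t) y)])%E
  end.

Definition kappa (d : nat) : R := fine (volume (@unit_ball d)).

Definition convex_set (n : nat) (K : set 'rV[R]_n) : Prop :=
  forall x y t, K x -> K y -> 0 <= t <= 1 -> K (t *: x + (1 - t) *: y).

Definition convex_body (n : nat) (K : set 'rV[R]_n) : Prop :=
  convex_set K /\ compact K /\ (interior K !=set0).

Definition origin_symmetric (n : nat) (K : set 'rV[R]_n) : Prop :=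
  forall x, K x -> K (- x).

Definition support_fun (n : nat) (K : set 'rV[R]_n) (x : 'rV[R]_n) : R :=
  sup [set dotv x y | y in K].

(* Wulff shape (Alexandrov body) of f : S^{n-1} -> (0,oo): the largest
   convex body whose support function is <= f on S^{n-1}, i.e.
   W(f) = {x | <x,u> <= f(u) for all u in S^{n-1}}. *)
Definition wulff (n : nat) (f : 'rV[R]_n -> R) : set 'rV[R]_n :=
  [set x | forall u, @unit_sphere n u -> dotv x u <= f u].

Definition Lp_comb (n : nat) (p lam : R) (K L : set 'rV[R]_n) : set 'rV[R]_n :=
  if p == 0 then
    wulff (fun u => (support_fun K u `^ (1 - lam)) * (support_fun L u `^ lam))
  else
    wulff (fun u => ((1 - lam) * support_fun K u `^ p
                     + lam * support_fun L u `^ p) `^ (p^-1)).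

Definition parallel_body (n : nat) (K : set 'rV[R]_n) (rho : R) : set 'rV[R]_n :=
  [set z | exists x b, K x /\ @unit_ball n b /\ z = x + rho *: b].

Definition steiner_coeffs (n : nat) (K : set 'rV[R]_n) (V : nat -> R) : Prop :=
  forall rho : R, 0 < rho ->
    volume (parallel_body K rho) =
      (\sum_(j < n.+1) rho ^+ (n - j) * kappa (n - j) * V j)%:E.

(* intrinsic volumes V_0(K), ..., V_n(K): the (unique) coefficients in the
   Steiner formula *)
Definition intrinsic_volume (n : nat) (K : set 'rV[R]_n) (j : nat) : R :=
  epsilon (inhabits (fun _ : nat => 0)) (steiner_coeffs K) j.

End ConvexGeometry.

(* Main.v *)
(* Both bodies are boxes. The [p]-mean is homogeneous and, for [p <= 1], lies
   below its tangent planes, so that the [L_p] combination of two boxes is the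
   box whose half-widths are the [p]-means of the half-widths. Slicing a
   neighborhood of a box shows that the [j]-th intrinsic volume of a box is the
   [j]-th elementary symmetric function [e_j] of its widths. It remains to find
   positive vectors with [e_j (M_p(a, b)) < (e_j a)^(1 - lam) (e_j b)^lam]. In
   the plane and for [j = 1], take [a = (1, r)] and [b = (r, 1)]: both sums
   exceed [1], while [M_p(1, r) + M_p(r, 1)] drops below [1] for small [r]
   because [p < 1]. Appending to both vectors a common entry [t] adds [t e_j] to
   [e_(j + 1)]: a tiny [t] preserves the inequality for a given [j] in one more
   dimension, and a huge [t] carries it from [j] to [j + 1]. *)
Require Import Defs.
From mathcomp Require Import all_boot all_order all_algebra.
From mathcomp Require Import all_classical all_reals all_analysis.
From mathcomp Require Import measurable_realfun ring lra zify.
Import Order.TTheory GRing.Theory Num.Theory.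
Import numFieldNormedType.Exports.
Local Open Scope classical_set_scope.
Local Open Scope ring_scope.
Set Implicit Arguments.
Unset Strict Implicit.

Section Substitution.
Context {R : realType}.
Local Notation mu := (@lebesgue_measure R).
Implicit Types (c e : R) (D : set R) (f : R -> \bar R).

Lemma preimage_affine_itvoc c e (a b : R) : 0 < c ->
  (fun t => c * t + e) @^-1` `]a, b] = `](a - e) / c, (b - e) / c]%classic.
Proof.
move=> c0; apply/seteqP; split=> t /=;
  by rewrite !in_itv/= ltr_pdivrMr// ler_pdivlMr// ltrBlDr lerBrDr (mulrC t).
Qed.

Lemma measurable_affine c e : measurable_fun [set: R] (fun t : R => c * t + e).
Proof. by apply: measurable_funD => //; exact: measurable_funM. Qed.

Lemma lebesgue_measure_affine c e (A : set R) : 0 < c -> measurable A ->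
  mu A = (c%:E * mu ((fun t : R => c * t + e)%R @^-1` A))%E.
Proof.
move=> c0; pose phi : measurableTypeR R -> measurableTypeR R :=
  fun t => c * t + e.
have mphi : measurable_fun [set: _] phi by exact: measurable_affine.
unshelve refine (@lebesgue_measure_unique R
  (mscale (NngNum (ltW c0)) (pushforward mu phi)) _ A) => //= _ [[a b]] _ <-.
transitivity (c%:E * mu `]((a - e) / c)%R, ((b - e) / c)%R])%E; last first.
  by rewrite -preimage_affine_itvoc.
rewrite !lebesgue_measure_itv/= !lte_fin ltr_pM2r ?invr_gt0// ltrD2r.
case: ifPn => _; last by rewrite mule0.
by rewrite -EFinD -EFinM; congr EFin; field; rewrite gt_eqF.
Qed.

Lemma ge0_integral_affine c e D f : 0 < c -> measurable D ->
  measurable_fun D f -> (forall t, D t -> (0 <= f t)%E) ->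
  (\int[mu]_(t in D) f t =
   c%:E * \int[mu]_(t in (fun t : R => c * t + e)%R @^-1` D) f (c * t + e)%R)%E.
Proof.
move=> c0 mD mf f0.
pose phi : measurableTypeR R -> measurableTypeR R := fun t => c * t + e.
have mphi : measurable_fun [set: _] phi by exact: measurable_affine.
have ic0 : 0 <= c^-1 by rewrite invr_ge0 ltW.
transitivity (c%:E * \int[mscale (NngNum ic0) mu]_(t in D) f t)%E.
  by rewrite ge0_integral_mscale//= muleA -EFinM divff ?gt_eqF// mul1e.
congr (_ * _)%E.
transitivity (\int[pushforward mu phi]_(t in D) f t)%E; last first.
  by rewrite (ge0_integral_pushforward mphi)// => t /[!inE]; exact: f0.
apply: eq_measure_integral => //= A mA _.
rewrite /mscale/= (lebesgue_measure_affine e c0 mA).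
by rewrite muleA -EFinM mulVf ?gt_eqF// mul1e.
Qed.

Lemma ge0_integral_even f : measurable_fun [set: R] f ->
  (forall t, (0 <= f t)%E) -> (forall t, f (- t) = f t) ->
  (\int[mu]_t f t = 2%:E * \int[mu]_(t in `[0%R, +oo[) f t)%E.
Proof.
move=> mf f0 fN.
have mfD (D : set R) : measurable_fun D f by exact: measurable_funS mf.
rewrite -(setUv `[0%R, +oo[%classic) ge0_integral_setU//=; last 3 first.
- exact: measurableC.
- exact: mfD.
- exact/disj_setPCl.
rewrite mule_natl mule2n; congr +%E.
rewrite setCitvr integral_itv_bndo_bndc// ge0_integration_by_substitution0//.
by apply: eq_integral => t _; rewrite fN.
Qed.

End Substitution.

Section DistanceToSymmetricInterval.
Context {R : realType}.
Local Notation mu := (@lebesgue_measure R).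
Implicit Types (a t : R) (g : R -> \bar R).

Definition dist_sym_itv a t : R := Num.max 0 (`|t| - a).

Lemma dist_sym_itv_ge0 a t : 0 <= dist_sym_itv a t.
Proof. by rewrite le_max lexx. Qed.

Lemma dist_sym_itvN a t : dist_sym_itv a (- t) = dist_sym_itv a t.
Proof. by rewrite /dist_sym_itv normrN. Qed.

Lemma dist_sym_itvD_le a x y : `|x| <= a -> dist_sym_itv a (x + y) <= `|y|.
Proof.
move=> xa; rewrite ge_max normr_ge0/= lerBlDl.
by rewrite (le_trans (ler_normD _ _))// lerD2r.
Qed.

Lemma measurable_dist_sym_itv a : measurable_fun [set: R] (dist_sym_itv a).
Proof. by apply: measurable_maxr => //; exact: measurable_funB. Qed.

Lemma ge0_integral_dist_sym_itv a g : 0 <= a -> measurable_fun [set: R] g ->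
  (forall t, (0 <= g t)%E) -> (forall t, g (- t) = g t) ->
  (\int[mu]_t g (dist_sym_itv a t) = (2 * a)%:E * g 0%R + \int[mu]_t g t)%E.
Proof.
move=> a0 mg g0 gN.
have mdist : measurable_fun [set: R] (g \o dist_sym_itv a).
  by apply: measurableT_comp => //; exact: measurable_dist_sym_itv.
rewrite ge0_integral_even//=; last by move=> t; rewrite dist_sym_itvN.
rewrite [in RHS]ge0_integral_even// EFinM -muleA -muleDr//; last first.
  by apply: ge0_adde_def; rewrite inE ?mule_ge0 ?integral_ge0 ?lee_fin.
congr *%E.
have itv_splitE : (`[0%R, +oo[ = `[0%R, a[ `|` `[a, +oo[)%classic.
  by apply: itv_bndbnd_setU; rewrite bnd_simp.
rewrite [in LHS]itv_splitE ge0_integral_setU//=; last 2 first.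
- exact: measurable_funS mdist.
- by apply/disj_setPS => t [/=]; rewrite !in_itv/= andbT => /andP[_]; case: ltP.
congr +%E.
  transitivity (\int[mu]_(t in `[0%R, a[) cst (g 0%R) t)%E.
    apply: eq_integral => t; rewrite inE/= in_itv/= => /andP[t0 ta].
    by rewrite /dist_sym_itv ger0_norm// max_l// subr_le0 ltW.
  rewrite integral_cst//= lebesgue_measure_itv/= lte_fin muleC.
  by move: a0; rewrite le_eqVlt => /predU1P[<-|->]; rewrite ?ltxx// oppr0 adde0.
rewrite [RHS](@ge0_integral_affine _ 1 (- a))//; last exact: measurable_funS mg.
rewrite mul1e (_ : _ @^-1` _ = `[a, +oo[%classic); last first.
  by apply/seteqP; split=> t /=; rewrite !in_itv/= !andbT mul1r subr_ge0.
apply: eq_integral => t; rewrite inE/= in_itv/= andbT => ta.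
by rewrite mul1r /dist_sym_itv ger0_norm ?(le_trans a0)// max_r// subr_ge0.
Qed.

End DistanceToSymmetricInterval.

Section RowCons.
Context {T : Type}.
Implicit Types (t : T).

Definition row_cons n t (y : 'rV[T]_n) : 'rV[T]_n.+1 :=
  row_mx (\row_(k < 1) t) y.

Lemma row_cons0 n t (y : 'rV[T]_n) : row_cons t y 0 ord0 = t.
Proof. by rewrite mxE; case: splitP => // k _; rewrite mxE. Qed.

Lemma row_consS n t (y : 'rV[T]_n) i : row_cons t y 0 (lift ord0 i) = y 0 i.
Proof.
have -> : lift ord0 i = rshift 1 i by exact/val_inj.
exact: row_mxEr.
Qed.

Lemma row_ind (P : forall n, 'rV[T]_n -> Prop) :
  (forall y : 'rV[T]_0, P 0%N y) ->
  (forall n t (y : 'rV[T]_n), P n y -> P n.+1 (row_cons t y)) ->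
  forall n (y : 'rV[T]_n), P n y.
Proof.
move=> P0 PS; elim=> [//|n IHn] y.
rewrite -(hsubmxK (y : 'rV_(1 + n))) (_ : lsubmx _ = \row__ y 0 ord0).
  exact: PS.
by apply/rowP=> k; rewrite !mxE ord1; congr (y _ _); exact: val_inj.
Qed.

Lemma forall_row_cons (P : T -> Prop) n t (y : 'rV[T]_n) :
  (forall i, P (row_cons t y 0 i)) <-> P t /\ forall i, P (y 0 i).
Proof.
split=> [Pty|[Pt Py] i].
  by split=> [|i]; [rewrite -(row_cons0 t y)|rewrite -(row_consS t)].
by case: (unliftP ord0 i) => [k|] ->; rewrite ?row_consS// row_cons0.
Qed.

Lemma map2_row_cons (f : T -> T -> T) n s t (x y : 'rV[T]_n) :
  map2_mx f (row_cons s x) (row_cons t y) = row_cons (f s t) (map2_mx f x y).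
Proof.
apply/rowP=> i; rewrite mxE.
by case: (unliftP ord0 i) => [k|] ->; rewrite ?row_cons0// !row_consS mxE.
Qed.

End RowCons.

Section Balls.
Context {R : realType}.
Local Notation mu := (@lebesgue_measure R).
Implicit Types (d : nat) (c s t : R).

Lemma volumeS d (A : set 'rV[R]_d.+1) :
  volume A = (\int[mu]_t volume [set y : 'rV[R]_d | A (row_cons t y)])%E.
Proof. by []. Qed.

(* A ball is parametrized by its squared radius: the section at [t] of the ball
   of squared radius [s] is the ball of squared radius [s - t ^+ 2], empty when
   this is negative. *)
Definition radius_pow d s : R := if 0 <= s then Num.sqrt s ^+ d else 0.

Lemma radius_pow_ge0 d s : 0 <= radius_pow d s.
Proof.
by rewrite /radius_pow; case: ifP => // _; rewrite exprn_ge0// sqrtr_ge0.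
Qed.

Lemma radius_pow_lt0 d s : s < 0 -> radius_pow d s = 0.
Proof. by rewrite /radius_pow ltNge => /negbTE ->. Qed.

Lemma radius_pow_sqr d c : 0 <= c -> radius_pow d (c ^+ 2) = c ^+ d.
Proof. by move=> c0; rewrite /radius_pow sqr_ge0 sqrtr_sqr ger0_norm. Qed.

Lemma radius_pow1 d : radius_pow d 1 = 1.
Proof. by rewrite /radius_pow ler01 sqrtr1 expr1n. Qed.

Lemma le_radius_pow d : {homo radius_pow d : s t / s <= t}.
Proof.
move=> s t st; rewrite {1}/radius_pow.
case: ifPn => [s0|_]; last exact: radius_pow_ge0.
by rewrite /radius_pow (le_trans s0 st) lerXn2r ?nnegrE ?sqrtr_ge0// ler_wsqrtr.
Qed.

Lemma radius_pow_scale d c s : 0 < c ->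
  radius_pow d (c ^+ 2 * s) = c ^+ d * radius_pow d s.
Proof.
move=> c0; rewrite /radius_pow pmulr_rge0 ?exprn_gt0//.
case: ifP => _; last by rewrite mulr0.
by rewrite sqrtrM ?sqr_ge0// sqrtr_sqr gtr0_norm// exprMn.
Qed.

Lemma measurable_radius_pow d : measurable_fun [set: R] (radius_pow d).
Proof.
apply: measurable_fun_ifT => //; first exact: measurable_fun_ler.
apply: measurable_funX; apply: continuous_measurable_fun.
exact: sqrt_continuous.
Qed.

Lemma measurable_radius_pow_slice d s :
  measurable_fun [set: R] (fun t => (radius_pow d (s - t ^+ 2))%:E).
Proof.
apply/measurable_EFinP/(measurableT_comp (measurable_radius_pow d)).
by apply: measurable_funB => //; exact: measurable_funX.
Qed.

Definition slice_integral d : \bar R :=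
  (\int[mu]_t (radius_pow d (1 - t ^+ 2))%:E)%E.

Lemma slice_integral_lty d : (slice_integral d < +oo)%E.
Proof.
apply: (@le_lt_trans _ _ (\int[mu]_t (\1_(`[(-1)%R, 1%R]%classic) t)%:E)%E).
  apply: ge0_le_integral => //.
  - by move=> t _; rewrite lee_fin radius_pow_ge0.
  - exact: measurable_radius_pow_slice.
  - by apply/measurable_EFinP; exact: measurable_indic.
  - move=> t _; rewrite lee_fin indicE; case: (boolP (t \in _)) => /= [_|].
      by rewrite -[leRHS](radius_pow1 d) le_radius_pow// gerBl sqr_ge0.
    rewrite notin_setE/= in_itv/= -ler_norml => /negP; rewrite -ltNge => t1.
    by rewrite radius_pow_lt0// subr_lt0 -real_normK ?num_real// exprn_egt1.
rewrite integral_indic//= setIT lebesgue_measure_itv/= lte_fin.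
by case: ifP => _; rewrite ?ltry// -EFinD ltry.
Qed.

Lemma slice_integral_gt0 d : (0 < slice_integral d)%E.
Proof.
have half0 : 0 < 2^-1 :> R by rewrite invr_gt0.
apply: (@lt_le_trans _ _
    (\int[mu]_(t in `[0%R, (2^-1)%R]) cst (2^-1 ^+ d)%:E t)%E).
  rewrite integral_cst//= lebesgue_measure_itv/= lte_fin half0.
  by rewrite -EFinB -EFinM lte_fin subr0 mulr_gt0// exprn_gt0.
apply: (@le_trans _ _
    (\int[mu]_(t in `[0%R, (2^-1)%R]) (radius_pow d (1 - t ^+ 2))%:E)%E).
  apply: ge0_le_integral => //.
  - by move=> t _; rewrite lee_fin exprn_ge0// ltW.
  - exact: measurable_funS (measurable_radius_pow_slice d 1).
  - move=> t /=; rewrite in_itv/= => /andP[t0 t1]; rewrite lee_fin.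
    by rewrite -(radius_pow_sqr d (ltW half0)) le_radius_pow//; nra.
apply: ge0_subset_integral => //; first exact: measurable_radius_pow_slice.
by move=> t _; rewrite lee_fin radius_pow_ge0.
Qed.

Lemma fine_slice_integralK d : (fine (slice_integral d))%:E = slice_integral d.
Proof.
by rewrite fineK// ge0_fin_numE ?slice_integral_lty// ltW// slice_integral_gt0.
Qed.

Lemma integral_radius_pow d s :
  (\int[mu]_t (radius_pow d (s - t ^+ 2))%:E =
   (fine (slice_integral d) * radius_pow d.+1 s)%:E)%E.
Proof.
have [s0|s0|->] := ltgtP s 0.
- rewrite radius_pow_lt0// mulr0; apply: integral0_eq => t _.
  by rewrite radius_pow_lt0// (le_lt_trans _ s0)// gerBl sqr_ge0.
- have c0 : 0 < Num.sqrt s by rewrite sqrtr_gt0.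
  have sE : s = Num.sqrt s ^+ 2 by rewrite sqr_sqrtr// ltW.
  move: (Num.sqrt s) c0 sE => c c0 ->.
  rewrite (@ge0_integral_affine _ c 0)//; last 2 first.
  - exact: measurable_radius_pow_slice.
  - by move=> t _; rewrite lee_fin radius_pow_ge0.
  rewrite preimage_setT radius_pow_sqr ?(ltW c0)// EFinM fine_slice_integralK.
  under eq_integral => t _.
    rewrite addr0 exprMn -[X in X - _]mulr1 -mulrBr radius_pow_scale// EFinM.
    over.
  rewrite ge0_integralZl_EFin ?exprn_ge0 ?(ltW c0)//; last 2 first.
  - by move=> t _; rewrite lee_fin radius_pow_ge0.
  - exact: measurable_radius_pow_slice.
  by rewrite muleA -EFinM -exprS muleC.
- rewrite [in RHS]/radius_pow lexx sqrtr0 expr0n/= mulr0.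
  transitivity (\int[mu]_(t in [set 0%R]) (radius_pow d (0 - t ^+ 2))%:E)%E.
    rewrite [RHS]integral_mkcond; apply: eq_integral => t _.
    rewrite patchE; case: ifPn => //; rewrite notin_setE/= => /eqP t0.
    by rewrite radius_pow_lt0// sub0r oppr_lt0 exprn_even_gt0.
  by rewrite integral_set1.
Qed.

Lemma dotv_row_cons d s t (x y : 'rV[R]_d) :
  dotv (row_cons s x) (row_cons t y) = s * t + dotv x y.
Proof.
rewrite /dotv big_ord_recl !row_cons0; congr (_ + _).
by apply: eq_bigr => i _; rewrite !row_consS.
Qed.

Definition sq_ball d s : set 'rV[R]_d := [set x | dotv x x <= s].

Lemma sq_ball_row_cons d s t :
  [set y | sq_ball s (row_cons t y)] = sq_ball (s - t ^+ 2) :> set 'rV[R]_d.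
Proof.
by apply/seteqP; split=> y; rewrite /sq_ball/= dotv_row_cons -expr2 lerBrDl.
Qed.

Lemma volume_sq_ball_radius_pow d :
  exists2 c, 0 < c & forall s, volume (@sq_ball d s) = (c * radius_pow d s)%:E.
Proof.
elim: d => [|d [c c0 IHd]].
  exists 1 => // s; rewrite mul1r /radius_pow expr0 /=.
  by rewrite /sq_ball/= /dotv big_ord0; case: asboolP; case: ifP.
exists (c * fine (slice_integral d)) => [|s].
  by rewrite mulr_gt0// fine_gt0// slice_integral_gt0 slice_integral_lty.
rewrite volumeS; under eq_integral do rewrite sq_ball_row_cons IHd EFinM.
rewrite ge0_integralZl_EFin ?(ltW c0)//; last 2 first.
- by move=> t _; rewrite lee_fin radius_pow_ge0.
- exact: measurable_radius_pow_slice.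
by rewrite integral_radius_pow -EFinM mulrA.
Qed.

Definition ball_volume d s : R := kappa R d * radius_pow d s.

Lemma volume_sq_ball d s : volume (@sq_ball d s) = (ball_volume d s)%:E.
Proof.
have [c _ vE] := volume_sq_ball_radius_pow d.
by rewrite /ball_volume /kappa (vE 1) vE radius_pow1 mulr1.
Qed.

Lemma kappa_gt0 d : 0 < kappa R d.
Proof.
have [c c0 vE] := volume_sq_ball_radius_pow d.
by rewrite /kappa (vE 1) radius_pow1 mulr1.
Qed.

Lemma ball_volume_ge0 d s : 0 <= ball_volume d s.
Proof. by rewrite mulr_ge0 ?radius_pow_ge0// ltW// kappa_gt0. Qed.

Lemma ball_volume_sqr d c : 0 <= c ->
  ball_volume d (c ^+ 2) = c ^+ d * kappa R d.
Proof. by move=> c0; rewrite /ball_volume radius_pow_sqr// mulrC. Qed.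

Lemma measurable_ball_volume_slice d s :
  measurable_fun [set: R] (fun t => (ball_volume d (s - t ^+ 2))%:E).
Proof.
under eq_fun do rewrite EFinM.
by apply: emeasurable_funM => //; exact: measurable_radius_pow_slice.
Qed.

Lemma integral_ball_volume d s :
  (\int[mu]_t (ball_volume d (s - t ^+ 2))%:E = (ball_volume d.+1 s)%:E)%E.
Proof.
rewrite -volume_sq_ball volumeS; apply: eq_integral => t _.
by rewrite sq_ball_row_cons volume_sq_ball.
Qed.

Lemma measurable_ball_volume_dist d a s :
  measurable_fun [set: R]
    (fun t => (ball_volume d (s - dist_sym_itv a t ^+ 2))%:E).
Proof.
apply: (measurableT_comp (measurable_ball_volume_slice d s)).
exact: measurable_dist_sym_itv.
Qed.

Lemma integral_ball_volume_dist d a s : 0 <= a ->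
  (\int[mu]_t (ball_volume d (s - dist_sym_itv a t ^+ 2))%:E =
   (2 * a * ball_volume d s + ball_volume d.+1 s)%:E)%E.
Proof.
move=> a0; pose g u := (ball_volume d (s - u ^+ 2))%:E.
rewrite (@ge0_integral_dist_sym_itv _ a g) /g//.
- by rewrite integral_ball_volume expr0n/= subr0 -EFinM -EFinD.
- exact: measurable_ball_volume_slice.
- by move=> t; rewrite lee_fin ball_volume_ge0.
- by move=> t; rewrite sqrrN.
Qed.

End Balls.

Section ElementarySymmetric.
Context {R : comNzRingType}.
Implicit Types (c t : R).

Definition elem_sym n (w : 'rV[R]_n) j : R :=
  (\prod_(i < n) (1 + w 0 i *: 'X))`_j.

Lemma elem_sym_row0 (w : 'rV[R]_0) j : elem_sym w j = (j == 0)%:R.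
Proof. by rewrite /elem_sym big_ord0 coef1. Qed.

Lemma elem_sym0 n (w : 'rV[R]_n) : elem_sym w 0 = 1.
Proof.
rewrite /elem_sym -horner_coef0 horner_prod big1// => i _.
by rewrite hornerD hornerZ hornerX mulr0 addr0 hornerC.
Qed.

Lemma elem_sym_row_cons n t (w : 'rV[R]_n) j :
  elem_sym (row_cons t w) j.+1 = elem_sym w j.+1 + t * elem_sym w j.
Proof.
rewrite /elem_sym big_ord_recl row_cons0; under eq_bigr do rewrite row_consS.
by rewrite mulrDl mul1r coefD -scalerAl coefZ coefXM.
Qed.

Lemma elem_sym_gt n (w : 'rV[R]_n) j : (n < j)%N -> elem_sym w j = 0.
Proof.
elim/@row_ind: n / w j => [w|n t w IHw] [//|j] nj.
  by rewrite elem_sym_row0.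
by rewrite elem_sym_row_cons !IHw ?mulr0 ?addr0// ltnW.
Qed.

Lemma sum_elem_sym_row_cons n t (w : 'rV[R]_n) (b : nat -> R) :
  \sum_(j < n.+2) elem_sym (row_cons t w) j * b (n.+1 - j)%N =
  \sum_(j < n.+1) elem_sym w j * (t * b (n - j)%N + b (n.+1 - j)%N).
Proof.
rewrite big_ord_recl elem_sym0 mul1r.
under [X in _ + X]eq_bigr do rewrite elem_sym_row_cons subSS mulrDl.
under [RHS]eq_bigr do rewrite mulrDr mulrCA mulrA.
rewrite !big_split/= addrA [RHS]addrC; congr +%R.
rewrite [RHS]big_ord_recl elem_sym0 mul1r; congr +%R.
by rewrite big_ord_recr/= elem_sym_gt// mul0r addr0.
Qed.

Lemma scale_row_cons n c t (w : 'rV[R]_n) :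
  c *: row_cons t w = row_cons (c * t) (c *: w).
Proof.
apply/rowP=> i; rewrite mxE.
by case: (unliftP ord0 i) => [k|] ->; rewrite ?row_cons0// !row_consS mxE.
Qed.

Lemma elem_symZ n c (w : 'rV[R]_n) j :
  elem_sym (c *: w) j = c ^+ j * elem_sym w j.
Proof.
elim/@row_ind: n / w j => [w|n t w IHw] [|j];
    rewrite ?elem_sym0 ?expr0 ?mulr1//.
  by rewrite !elem_sym_row0 mulr0.
by rewrite scale_row_cons !elem_sym_row_cons !IHw mulrDr exprS; congr +%R; ring.
Qed.

End ElementarySymmetric.

Section ElementarySymmetricNonneg.
Context {R : numDomainType}.
Implicit Types n j : nat.

Lemma elem_sym_ge0 n (w : 'rV[R]_n) j :
  (forall i, 0 <= w 0 i) -> 0 <= elem_sym w j.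
Proof.
elim/@row_ind: n / w j => [w|n t w IHw] [|j]; rewrite ?elem_sym0//.
  by rewrite elem_sym_row0.
move/(forall_row_cons (>= 0)) => [t0 w0].
by rewrite elem_sym_row_cons addr_ge0 ?mulr_ge0 ?IHw.
Qed.

Lemma elem_sym_le_row_cons n t (w : 'rV[R]_n) j : 0 <= t ->
  (forall i, 0 <= w 0 i) -> elem_sym w j.+1 <= elem_sym (row_cons t w) j.+1.
Proof.
by move=> t0 w0; rewrite elem_sym_row_cons lerDl mulr_ge0 ?elem_sym_ge0.
Qed.

Lemma mul_elem_sym_le_row_cons n t (w : 'rV[R]_n) j :
  (forall i, 0 <= w 0 i) -> t * elem_sym w j <= elem_sym (row_cons t w) j.+1.
Proof. by move=> w0; rewrite elem_sym_row_cons lerDr elem_sym_ge0. Qed.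

End ElementarySymmetricNonneg.

Section BoxNeighborhoods.
Context {R : realType}.

Definition box_nbhd n (a : 'rV[R]_n) s : set 'rV[R]_n :=
  [set z | \sum_(i < n) dist_sym_itv (a 0 i) (z 0 i) ^+ 2 <= s].

Lemma box_nbhd_row_cons n c (a : 'rV[R]_n) s t :
  [set y | box_nbhd (row_cons c a) s (row_cons t y)] =
  box_nbhd a (s - dist_sym_itv c t ^+ 2).
Proof.
have sumE (y : 'rV[R]_n) :
    \sum_(i < n.+1) dist_sym_itv (row_cons c a 0 i) (row_cons t y 0 i) ^+ 2 =
    dist_sym_itv c t ^+ 2 + \sum_(i < n) dist_sym_itv (a 0 i) (y 0 i) ^+ 2.
  rewrite big_ord_recl !row_cons0; congr (_ + _).
  by apply: eq_bigr => i _; rewrite !row_consS.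
by apply/seteqP; split=> y; rewrite /box_nbhd/= sumE lerBrDl.
Qed.

Lemma volume_box_nbhd n (a : 'rV[R]_n) s : (forall i, 0 <= a 0 i) ->
  volume (box_nbhd a s) =
  (\sum_(j < n.+1) elem_sym (2 *: a) j * ball_volume (n - j) s)%:E.
Proof.
elim/@row_ind: n / a s => [a|n c a IHa] s.
  rewrite big_ord1 elem_sym0 mul1r -volume_sq_ball => _.
  congr volume; apply/seteqP; split=> z;
    by rewrite /box_nbhd/= /sq_ball/= /dotv !big_ord0.
move/(forall_row_cons (>= 0)) => [c0 a0]; rewrite volumeS.
pose e := elem_sym (2 *: a).
have e0 j : 0 <= e j by apply: elem_sym_ge0 => i; rewrite mxE mulr_ge0.
under eq_integral do rewrite box_nbhd_row_cons IHa// -sumEFin.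
rewrite scale_row_cons (sum_elem_sym_row_cons _ _ (ball_volume ^~ s)).
rewrite ge0_integral_sum//; last 2 first.
- move=> j; under eq_fun do rewrite EFinM.
  by apply: emeasurable_funM => //; exact: measurable_ball_volume_dist.
- by move=> j t _; rewrite lee_fin mulr_ge0 ?ball_volume_ge0// e0.
rewrite -sumEFin; apply: eq_bigr => j _; under eq_integral do rewrite EFinM.
rewrite ge0_integralZl_EFin ?e0//; last 2 first.
- by move=> t _; rewrite lee_fin ball_volume_ge0.
- exact: measurable_ball_volume_dist.
by rewrite integral_ball_volume_dist// -EFinM subSn// -ltnS.
Qed.

End BoxNeighborhoods.

Section IntrinsicVolumes.
Context {R : realType}.

Lemma poly_eq0_gt0 (P : {poly R}) : (forall x, 0 < x -> P.[x] = 0) -> P = 0.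
Proof.
move=> P0.
apply: (@roots_geq_poly_eq0 _ _ [seq k.+1%:R | k <- iota 0 (size P)]).
- by apply/allP => _ /mapP[k _ ->]; rewrite rootE P0.
- by rewrite map_inj_uniq ?iota_uniq// => k l /eqP; rewrite eqr_nat => /eqP[].
- by rewrite size_map size_iota.
Qed.

Lemma steiner_coeffs_unique n (K : set 'rV[R]_n) (V W : nat -> R) j :
  (j <= n)%N -> steiner_coeffs K V -> steiner_coeffs K W -> V j = W j.
Proof.
move=> jn hV hW; pose c k := kappa R k * (V (n - k)%N - W (n - k)%N).
have /(congr1 (fun P : {poly R} => P`_(n - j))) : \poly_(k < n.+1) c k = 0.
  apply: poly_eq0_gt0 => r r0; have [] := etrans (esym (hV r r0)) (hW r r0).
  move=> /eqP; rewrite -subr_eq0 -sumrB => /eqP sum0.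
  rewrite horner_poly (reindex_inj rev_ord_inj)/= -[RHS]sum0.
  by apply: eq_bigr => i _; rewrite subSS /c subKn -1?ltnS//; ring.
rewrite coef_poly ltnS leq_subr coef0 /c subKn// => /eqP.
by rewrite mulf_eq0 gt_eqF ?kappa_gt0//= subr_eq0 => /eqP.
Qed.

Lemma intrinsic_volume_eq n (K : set 'rV[R]_n) V j :
  (j <= n)%N -> steiner_coeffs K V -> intrinsic_volume K j = V j.
Proof.
move=> jn KV; apply: (steiner_coeffs_unique jn _ KV).
exact: (ClassicalEpsilon.epsilon_spec _ _ (ex_intro _ _ KV)).
Qed.

End IntrinsicVolumes.

Section Boxes.
Context {R : realType}.
Implicit Types n : nat.

Definition box n (a : 'rV[R]_n) : set 'rV[R]_n :=
  [set x | forall i, `|x 0 i| <= a 0 i].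

Lemma convex_box n (a : 'rV[R]_n) : Defs.convex_set (box a).
Proof.
move=> x y t xa ya /andP[t0 t1] i; rewrite !mxE.
have t1' : 0 <= 1 - t by rewrite subr_ge0.
rewrite (le_trans (ler_normD _ _))// !normrM (ger0_norm t0) (ger0_norm t1').
rewrite [leRHS](_ : _ = t * a 0 i + (1 - t) * a 0 i); last by ring.
by rewrite lerD// ler_wpM2l.
Qed.

Lemma origin_symmetric_box n (a : 'rV[R]_n) : origin_symmetric (box a).
Proof. by move=> x xa i; rewrite mxE normrN. Qed.

Lemma compact_box n (a : 'rV[R]_n) : compact (box a).
Proof.
rewrite (_ : box a = [set x | forall i, `[- a 0 i, a 0 i]%classic (x 0 i)]).
  exact: (@rV_compact R n _ (fun i => @segment_compact _ _ _)).
by apply/seteqP; split=> x xa i; have := xa i; rewrite /= in_itv/= ler_norml.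
Qed.

Lemma convex_body_box n (a : 'rV[R]_n) :
  (forall i, 0 < a 0 i) -> convex_body (box a).
Proof.
move=> a0; split; first exact: convex_box.
split; first exact: compact_box.
pose e := \big[Num.min/1]_(i < n) a 0 i.
have e0 : 0 < e.
  by rewrite /e; elim/big_ind: _ => // x y x0 y0; rewrite lt_min x0.
exists 0; apply/nbhs_ballP; exists e => //= x [_ xe] i.
have := xe 0 i; rewrite /ball/= mxE sub0r normrN => /ltW/le_trans; apply.
exact: bigmin_le_cond.
Qed.

Definition clamp (a t : R) : R := Num.max (- a) (Num.min t a).

Lemma norm_clamp a t : 0 <= a -> `|clamp a t| <= a.
Proof.
move=> a0; rewrite ler_norml /clamp le_max lexx/= ge_max ge_min lexx orbT andbT.
by rewrite ge0_cp.
Qed.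

Lemma norm_sub_clamp a t : 0 <= a -> `|t - clamp a t| = dist_sym_itv a t.
Proof.
move=> a0; rewrite /clamp /dist_sym_itv; have [ta|at_] := leP t a.
  have [aNt|taN] := leP (- a) t.
    by rewrite subrr normr0 max_l// subr_le0 ler_norml aNt.
  by rewrite !ltr0_norm ?max_r; lra.
by rewrite max_r ?gtr0_norm ?max_r; lra.
Qed.

Lemma parallel_body_box n (a : 'rV[R]_n) rho :
  (forall i, 0 <= a 0 i) -> 0 < rho ->
  parallel_body (box a) rho = box_nbhd a (rho ^+ 2).
Proof.
move=> a0 rho0; apply/seteqP; split=> z.
  move=> [x [b [xa [b1 ->]]]]; rewrite /box_nbhd/=.
  apply: (@le_trans _ _ (rho ^+ 2 * dotv b b)); last first.
    by rewrite ler_piMr ?sqr_ge0.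
  rewrite /dotv mulr_sumr; apply: ler_sum => i _; rewrite !mxE -expr2 -exprMn.
  rewrite -[leRHS]real_normK ?num_real// lerXn2r ?nnegrE ?dist_sym_itv_ge0//.
  exact: dist_sym_itvD_le.
rewrite /box_nbhd/= => zs.
pose x : 'rV[R]_n := \row_i clamp (a 0 i) (z 0 i).
exists x, (rho^-1 *: (z - x)); split; first by move=> i; rewrite mxE norm_clamp.
split; last by rewrite scalerA divff ?gt_eqF// scale1r addrC subrK.
rewrite /unit_ball/= (_ : dotv _ _ =
    (rho ^+ 2)^-1 * \sum_(i < n) dist_sym_itv (a 0 i) (z 0 i) ^+ 2).
  by rewrite ler_pdivrMl ?exprn_gt0// mulr1.
rewrite mulr_sumr; apply: eq_bigr => i _.
by rewrite !mxE -expr2 exprMn exprVn -norm_sub_clamp// real_normK ?num_real.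
Qed.

Lemma steiner_coeffs_box n (a : 'rV[R]_n) : (forall i, 0 <= a 0 i) ->
  steiner_coeffs (box a) (elem_sym (2 *: a)).
Proof.
move=> a0 rho rho0; rewrite parallel_body_box// volume_box_nbhd//; congr EFin.
by apply: eq_bigr => j _; rewrite ball_volume_sqr ?ltW// mulrC.
Qed.

Lemma intrinsic_volume_box n (a : 'rV[R]_n) j : (forall i, 0 <= a 0 i) ->
  (j <= n)%N -> intrinsic_volume (box a) j = 2 ^+ j * elem_sym a j.
Proof.
move=> a0 jn; rewrite -elem_symZ.
exact: intrinsic_volume_eq jn (steiner_coeffs_box a0).
Qed.

Lemma intrinsic_volume_box_ge0 n (a : 'rV[R]_n) j : (forall i, 0 <= a 0 i) ->
  (j <= n)%N -> 0 <= intrinsic_volume (box a) j.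
Proof.
move=> a0 jn; rewrite intrinsic_volume_box//.
by rewrite mulr_ge0 ?exprn_ge0 ?elem_sym_ge0.
Qed.

Lemma support_fun_box n (a u : 'rV[R]_n) : (forall i, 0 <= a 0 i) ->
  support_fun (box a) u = \sum_(i < n) a 0 i * `|u 0 i|.
Proof.
move=> a0; set h := \sum_(i < n) _.
have ub_h : ubound [set dotv u y | y in box a] h.
  move=> _ [y ya <-]; apply: ler_sum => i _.
  by rewrite (le_trans (ler_norm _))// normrM mulrC ler_wpM2r.
have h_attained : [set dotv u y | y in box a] h.
  exists (\row_i (a 0 i * Num.sg (u 0 i))) => [i|].
    by rewrite mxE normrM ger0_norm// ler_piMr// normr_sg; case: (_ == 0).
  by apply: eq_bigr => i _; rewrite mxE mulrCA normrEsg [u 0 i * _]mulrC.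
apply/le_anti/andP; split.
  by apply: ge_sup => //; exists h.
by apply: ub_le_sup => //; exists h.
Qed.

End Boxes.

Section LpMeans.
Context {R : realType}.
Implicit Types p q lam x y : R.

Definition Lp_mean p lam x y : R :=
  if p == 0 then x `^ (1 - lam) * y `^ lam
  else ((1 - lam) * x `^ p + lam * y `^ p) `^ p^-1.

Lemma Lp_mean0 lam x y : Lp_mean 0 lam x y = x `^ (1 - lam) * y `^ lam.
Proof. by rewrite /Lp_mean eqxx. Qed.

Lemma Lp_mean_neq0 p lam x y : p != 0 ->
  Lp_mean p lam x y = ((1 - lam) * x `^ p + lam * y `^ p) `^ p^-1.
Proof. by move=> /negbTE p0; rewrite /Lp_mean p0. Qed.

Lemma Lp_mean_ge0 p lam x y : 0 <= Lp_mean p lam x y.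
Proof. by rewrite /Lp_mean; case: (p == 0); rewrite ?mulr_ge0 ?powR_ge0. Qed.

Lemma Lp_mean_onem p lam x y : Lp_mean p (1 - lam) x y = Lp_mean p lam y x.
Proof.
rewrite /Lp_mean subKr; case: (p == 0); first exact: mulrC.
by congr (_ `^ _); exact: addrC.
Qed.

Lemma powRK p x : p != 0 -> 0 <= x -> (x `^ p) `^ p^-1 = x.
Proof. by move=> p0 x0; rewrite -powRrM divff// powRr1. Qed.

Section Weighted.
Variable lam : R.
Hypothesis lam01 : 0 < lam < 1.

Let lam0 : 0 < lam. Proof. by case/andP: lam01. Qed.
Let onem_lam0 : 0 < 1 - lam. Proof. by case/andP: lam01; rewrite subr_gt0. Qed.

Lemma weighted_sum_ge0 x y : 0 <= x -> 0 <= y -> 0 <= (1 - lam) * x + lam * y.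
Proof. by move=> x0 y0; rewrite addr_ge0// mulr_ge0// ltW. Qed.

Lemma Lp_meanZ p c x y : 0 <= c -> 0 <= x -> 0 <= y ->
  Lp_mean p lam (c * x) (c * y) = c * Lp_mean p lam x y.
Proof.
move=> c0 x0 y0; have [->|p0] := eqVneq p 0.
  rewrite !Lp_mean0 !powRM// mulrACA -powRD ?subrK ?oner_eq0//.
  by rewrite powRr1.
rewrite !Lp_mean_neq0// !powRM// (mulrCA (1 - lam)) (mulrCA lam) -mulrDr.
by rewrite powRM ?weighted_sum_ge0 ?powR_ge0// powRK.
Qed.

Lemma Lp_mean_id p x : 0 <= x -> Lp_mean p lam x x = x.
Proof.
move=> x0; rewrite -{1 2}(mulr1 x) Lp_meanZ//.
by rewrite /Lp_mean !powR1 !mulr1 subrK powR1 if_same mulr1.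
Qed.

Lemma le_Lp_mean p x y x' y' : 0 <= p -> 0 <= x <= x' -> 0 <= y <= y' ->
  Lp_mean p lam x y <= Lp_mean p lam x' y'.
Proof.
move=> p0 /andP[x0 xx'] /andP[y0 yy'].
have [x'0 y'0] := (le_trans x0 xx', le_trans y0 yy').
have [->|pn0] := eqVneq p 0.
  by rewrite !Lp_mean0 ler_pM ?powR_ge0// ge0_ler_powR ?nnegrE// ltW.
rewrite !(Lp_mean_neq0 _ _ _ pn0).
apply: ge0_ler_powR; rewrite ?nnegrE ?invr_ge0//.
- by rewrite weighted_sum_ge0 ?powR_ge0.
- by rewrite weighted_sum_ge0 ?powR_ge0.
- by rewrite lerD// ler_wpM2l ?ge0_ler_powR ?nnegrE// ltW.
Qed.

Lemma Lp_mean_le_arith p x y : 0 <= p <= 1 -> 0 <= x -> 0 <= y ->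
  Lp_mean p lam x y <= (1 - lam) * x + lam * y.
Proof.
move=> /andP[p0 p1] x0 y0; have [->|pn0] := eqVneq p 0.
  have := @conjugate_powR _ (x `^ (1 - lam)) (y `^ lam) (1 - lam)^-1 lam^-1.
  rewrite !powR_ge0 !invr_gt0 !invrK subrK => /(_ isT isT onem_lam0 lam0 erefl).
  by rewrite Lp_mean0 !powRK ?gt_eqF// (mulrC x) (mulrC y).
have pp : 0 < p by rewrite lt0r pn0.
have ip1 : 1 <= p^-1 by rewrite invf_ge1.
have /andP[_ lam1] := lam01.
have /(_ (y `^ p) (x `^ p)) := convex_powR ip1 (Itv01 (ltW lam0) (ltW lam1)).
rewrite !inE/= !in_itv/= !powR_ge0 => /(_ isT isT).
rewrite [X in X `^ _ <= _]convRE convRE/= !powRK// addrC [leRHS]addrC.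
by rewrite Lp_mean_neq0.
Qed.

Lemma Lp_mean_powR p q x y : 0 < q -> 0 <= x -> 0 <= y ->
  Lp_mean p lam x y `^ q = Lp_mean (p / q) lam (x `^ q) (y `^ q).
Proof.
move=> q0 x0 y0; have [->|p0] := eqVneq p 0.
  rewrite mul0r !Lp_mean0 (powRM _ (powR_ge0 _ _) (powR_ge0 _ _)).
  by rewrite (powRAC x _ q) (powRAC y _ q).
have q_neq0 : q != 0 by rewrite gt_eqF.
rewrite !Lp_mean_neq0 ?mulf_neq0 ?invr_neq0// -!powRrM.
by rewrite invf_div (mulrC q p^-1) (mulrC q (p / q)) divfK.
Qed.

Lemma Lp_mean_homo_exp p q x y : 0 <= p <= q -> 0 < q -> 0 <= x -> 0 <= y ->
  Lp_mean p lam x y <= Lp_mean q lam x y.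
Proof.
move=> /andP[p0 pq] q0 x0 y0; have q_neq0 : q != 0 by rewrite gt_eqF.
rewrite -(powRK q_neq0 (Lp_mean_ge0 p lam x y)) Lp_mean_powR//.
rewrite [leRHS]Lp_mean_neq0//; apply: ge0_ler_powR; rewrite ?nnegrE.
- by rewrite invr_ge0 ltW.
- exact: Lp_mean_ge0.
- by rewrite weighted_sum_ge0 ?powR_ge0.
- apply: Lp_mean_le_arith; rewrite ?powR_ge0//.
  by rewrite divr_ge0 ?(ltW q0)//= ler_pdivrMr// mul1r.
Qed.

End Weighted.

Lemma Lp_mean_reweight p lam X Y : 0 < lam < 1 -> 0 < X -> 0 < Y ->
  exists2 w, 0 < w < 1 & forall x y, 0 <= x -> 0 <= y ->
    Lp_mean p lam (X * x) (Y * y) = Lp_mean p lam X Y * Lp_mean p w x y.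
Proof.
move=> lam01 X0 Y0; have /andP[lam0 lam1] := lam01.
have onem_lam0 : 0 < 1 - lam by rewrite subr_gt0.
have [->|p0] := eqVneq p 0.
  exists lam => // x y x0 y0.
  by rewrite !Lp_mean0 !powRM ?(ltW X0) ?(ltW Y0)// mulrACA.
pose A := (1 - lam) * X `^ p; pose B := lam * Y `^ p.
have A0 : 0 < A by rewrite mulr_gt0 ?powR_gt0.
have B0 : 0 < B by rewrite mulr_gt0 ?powR_gt0.
have AB0 : 0 < A + B by rewrite addr_gt0.
have w01 : 0 < B / (A + B) < 1.
  by rewrite divr_gt0//= ltr_pdivrMr// mul1r ltrDr.
exists (B / (A + B)) => // x y x0 y0.
rewrite !Lp_mean_neq0// !powRM ?(ltW X0) ?(ltW Y0)// -/A -/B.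
rewrite -[in RHS]powRM ?(ltW AB0) ?weighted_sum_ge0 ?powR_ge0//; congr (_ `^ _).
by rewrite (mulrA (1 - lam)) (mulrA lam) -/A -/B; field; rewrite gt_eqF.
Qed.

Lemma Lp_mean_sum_le p lam (I : finType) (f g : I -> R) :
    0 <= p <= 1 -> 0 < lam < 1 ->
    (forall i, 0 <= f i) -> (forall i, 0 <= g i) ->
    0 < \sum_i f i -> 0 < \sum_i g i ->
  \sum_i Lp_mean p lam (f i) (g i) <= Lp_mean p lam (\sum_i f i) (\sum_i g i).
Proof.
move=> p01 lam01 f0 g0; set X := \sum_i f i; set Y := \sum_i g i => X0 Y0.
have [w w01 reweight] := Lp_mean_reweight p lam01 X0 Y0.
(* A linear majorant of the mean that is exact at [(X, Y)]. *)
have majorant i : Lp_mean p lam (f i) (g i) <=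
    Lp_mean p lam X Y * ((1 - w) * (X^-1 * f i) + w * (Y^-1 * g i)).
  rewrite -{1}(mulVKf (lt0r_neq0 X0) (f i)) -{1}(mulVKf (lt0r_neq0 Y0) (g i)).
  rewrite reweight ?mulr_ge0 ?invr_ge0 ?(ltW X0) ?(ltW Y0)//.
  rewrite ler_wpM2l ?Lp_mean_ge0// Lp_mean_le_arith//;
    by rewrite mulr_ge0// invr_ge0 ltW.
rewrite (le_trans (ler_sum _ (fun i _ => majorant i)))//.
rewrite -mulr_sumr big_split/= -!mulr_sumr !mulVf ?gt_eqF// !mulr1 subrK.
by rewrite mulr1.
Qed.

End LpMeans.

Section LpCombinationOfBoxes.
Context {R : realType}.
Implicit Types (p lam : R) (n : nat).

Lemma Lp_comb_wulff p lam n (K L : set 'rV[R]_n) : Lp_comb p lam K L =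
  wulff (fun u => Lp_mean p lam (support_fun K u) (support_fun L u)).
Proof.
rewrite /Lp_comb /Lp_mean; case: ifP => p0; congr wulff; exact/funext.
Qed.

Lemma dotv_delta n (x : 'rV[R]_n) s i : dotv x (s *: delta_mx 0 i) = x 0 i * s.
Proof.
rewrite /dotv (bigD1 i)//= !mxE !eqxx mulr1 big1 ?addr0// => k /negbTE ki.
by rewrite !mxE ki andbF !mulr0.
Qed.

Lemma support_fun_box_delta n (a : 'rV[R]_n) s i : (forall i, 0 <= a 0 i) ->
  support_fun (box a) (s *: delta_mx 0 i) = a 0 i * `|s|.
Proof.
move=> a0; rewrite support_fun_box// (bigD1 i)//= !mxE !eqxx mulr1.
rewrite big1 ?addr0// => k /negbTE ki.
by rewrite !mxE ki andbF mulr0 normr0 mulr0.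
Qed.

Lemma support_fun_box_gt0 n (a u : 'rV[R]_n) : (forall i, 0 < a 0 i) ->
  unit_sphere u -> 0 < support_fun (box a) u.
Proof.
move=> a0 u1; have a_ge0 i := ltW (a0 i).
have au_ge0 i : 0 <= a 0 i * `|u 0 i| by rewrite mulr_ge0.
rewrite support_fun_box// lt0r sumr_ge0// andbT psumr_neq0//.
apply/contraT => /hasPn/= au0; have := oner_eq0 R.
rewrite -u1 /dotv big1 ?eqxx// => i _.
have := au0 i (mem_index_enum i); rewrite lt0r au_ge0 andbT negbK mulf_eq0.
by rewrite gt_eqF//= normr_eq0 => /eqP ->; rewrite mul0r.
Qed.

Lemma Lp_comb_box p lam n (a b : 'rV[R]_n) : 0 <= p <= 1 -> 0 < lam < 1 ->
    (forall i, 0 < a 0 i) -> (forall i, 0 < b 0 i) ->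
  Lp_comb p lam (box a) (box b) = box (map2_mx (Lp_mean p lam) a b).
Proof.
move=> p01 lam01 a0 b0.
have [a_ge0 b_ge0] := (fun i => ltW (a0 i), fun i => ltW (b0 i)).
rewrite Lp_comb_wulff; apply/seteqP; split=> x.
  move=> xW i; rewrite mxE ler_norml lerNl.
  have axis s : `|s| = 1 -> x 0 i * s <= Lp_mean p lam (a 0 i) (b 0 i).
    move=> s1; have := xW (s *: delta_mx 0 i).
    rewrite dotv_delta !support_fun_box_delta// s1 !mulr1; apply.
    rewrite /unit_sphere/= dotv_delta !mxE !eqxx mulr1 -expr2.
    by rewrite -real_normK ?num_real// s1 expr1n.
  have := axis 1 (normr1 _); have := axis (-1) (normrN1 _).
  by rewrite mulrN1 mulr1 => -> ->.
move=> xM u u1.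
have := support_fun_box_gt0 a0 u1; have := support_fun_box_gt0 b0 u1.
rewrite !support_fun_box// => B0 A0.
rewrite (le_trans _ (Lp_mean_sum_le _ _ _ _ A0 B0))//; last 2 first.
- by move=> i; rewrite mulr_ge0.
- by move=> i; rewrite mulr_ge0.
apply: ler_sum => i _; rewrite (le_trans (ler_norm _))// normrM.
rewrite ![_ * `|u 0 i|]mulrC Lp_meanZ// ler_wpM2l//.
by have := xM i; rewrite mxE.
Qed.

Lemma intrinsic_volume_Lp_comb_box p lam n (a b : 'rV[R]_n) j :
    0 <= p <= 1 -> 0 < lam < 1 ->
    (forall i, 0 < a 0 i) -> (forall i, 0 < b 0 i) -> (j <= n)%N ->
  intrinsic_volume (Lp_comb p lam (box a) (box b)) j =
  2 ^+ j * elem_sym (map2_mx (Lp_mean p lam) a b) j.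
Proof.
move=> p01 lam01 a0 b0 jn; rewrite Lp_comb_box// intrinsic_volume_box// => i.
by rewrite mxE Lp_mean_ge0.
Qed.

End LpCombinationOfBoxes.

Section WidthVectors.
Context {R : realType}.
Implicit Types (p lam r s t : R) (n j : nat).

Lemma gt1r_powR s t : 0 < s < 1 -> 1 < t -> s `^ t < s.
Proof.
move=> /andP[s0 s1] t1; rewrite -mulr_powRB1 ?(ltW s0) ?(lt_trans ltr01)//.
rewrite gtr_pMr// -[ltRHS](congr1 (@^~ (t - 1)) (@powR1 R)).
by rewrite gt0_ltr_powR ?nnegrE ?subr_gt0 ?(ltW s0).
Qed.

Lemma cvg_Lp_mean_1r p lam : 0 < p -> 0 < lam < 1 ->
  Lp_mean p lam 1 r @[r --> 0^'+] --> (1 - lam) `^ p^-1.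
Proof.
move=> p0 /andP[_ lam1].
have inner_cvg : (1 - lam + lam * r `^ p) @[r --> 0^'+] --> 1 - lam + lam * 0.
  apply: cvgD; first exact: cvg_cst.
  by apply: cvgM; [exact: cvg_cst|exact: powR_cvg0].
have powR_continuous : {for 1 - lam, continuous (@powR R ^~ p^-1)}.
  apply/differentiable_continuous/derivable1_diffP/derivable_powR.
  by rewrite in_itv/= subr_gt0 lam1.
rewrite mulr0 addr0 in inner_cvg.
under eq_fun do rewrite Lp_mean_neq0 ?gt_eqF// powR1 mulr1.
exact: cvg_comp inner_cvg powR_continuous.
Qed.

Lemma exists_Lp_mean_swap_lt1 p lam : 0 <= p < 1 -> 0 < lam < 1 ->
  exists2 r, 0 < r & Lp_mean p lam 1 r + Lp_mean p lam r 1 < 1.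
Proof.
move=> /andP[p0 p1] lam01; have /andP[lam0 lam1] := lam01.
have onem_lam01 : 0 < 1 - lam < 1 by rewrite subr_gt0 lam1 gtrBl.
(* Means increase with the exponent, so a positive [q < 1] covers [p = 0]. *)
pose q := Num.max p 2^-1.
have q0 : 0 < q by rewrite lt_max invr_gt0 ltr0n orbT.
have iq1 : 1 < q^-1 by rewrite invf_gt1// gt_max p1 invf_lt1// ltr1n.
have sum_lt1 : (1 - lam) `^ q^-1 + lam `^ q^-1 < 1.
  by rewrite -[ltRHS](subrK lam) ltrD// gt1r_powR.
have cvg_sum : (Lp_mean q lam 1 r + Lp_mean q (1 - lam) 1 r) @[r --> 0^'+] -->
    (1 - lam) `^ q^-1 + lam `^ q^-1.
  rewrite -[X in _ + X `^ _](subKr 1); apply: cvgD; exact: cvg_Lp_mean_1r.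
near (0 : R)^'+ => r.
have r0 : 0 < r by near: r; exact: nbhs_right_gt.
have pq : 0 <= p <= q by rewrite p0 le_max lexx.
exists r => //.
apply: (@le_lt_trans _ _ (Lp_mean q lam 1 r + Lp_mean q lam r 1)).
  by apply: lerD; apply: Lp_mean_homo_exp => //; exact: ltW.
rewrite -[X in _ + X]Lp_mean_onem; near: r; exact: cvgr_lt cvg_sum _ sum_lt1.
Unshelve. all: by end_near. Qed.

Definition log_BM_fails p lam n j := exists a b : 'rV[R]_n,
  [/\ forall i, 0 < a 0 i, forall i, 0 < b 0 i &
    elem_sym (map2_mx (Lp_mean p lam) a b) j <
    Lp_mean 0 lam (elem_sym a j) (elem_sym b j)].

Lemma log_BM_fails_plane p lam : 0 <= p < 1 -> 0 < lam < 1 ->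
  log_BM_fails p lam 2 1.
Proof.
move=> p01 lam01; have [r r0 r_lt1] := exists_Lp_mean_swap_lt1 p01 lam01.
have row2_gt0 s t (v : 'rV[R]_0) : 0 < s -> 0 < t ->
    forall i, 0 < row_cons s (row_cons t v) 0 i.
  move=> s0 t0; apply/(forall_row_cons (> 0)); split=> //.
  by apply/(forall_row_cons (> 0)); split=> // -[].
have elem_sym1_row2 s t (v : 'rV[R]_0) :
    elem_sym (row_cons s (row_cons t v)) 1 = s + t.
  by rewrite !elem_sym_row_cons !elem_sym0 elem_sym_row0/= add0r !mulr1 addrC.
exists (row_cons 1 (row_cons r 0)), (row_cons r (row_cons 1 0)).
split; [exact: row2_gt0|exact: row2_gt0|].
rewrite !map2_row_cons !elem_sym1_row2 (addrC r).
rewrite (Lp_mean_id lam01 0 (ltW (addr_gt0 ltr01 r0))).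
by apply: lt_trans r_lt1 _; rewrite ltrDl.
Qed.

Section CommonEdge.
Variables (p lam : R) (n j : nat).
Hypothesis lam01 : 0 < lam < 1.

Lemma elem_sym_Lp_mean_ge0 (a b : 'rV[R]_n) k :
  0 <= elem_sym (map2_mx (Lp_mean p lam) a b) k.
Proof. by apply: elem_sym_ge0 => i; rewrite mxE Lp_mean_ge0. Qed.

Lemma log_BM_fails_row_cons (a b : 'rV[R]_n) t
    (m := map2_mx (Lp_mean p lam) a b) :
    (forall i, 0 < a 0 i) -> (forall i, 0 < b 0 i) -> 0 < t ->
    elem_sym m j.+1 + t * elem_sym m j <
    Lp_mean 0 lam (elem_sym (row_cons t a) j.+1)
      (elem_sym (row_cons t b) j.+1) ->
  log_BM_fails p lam n.+1 j.+1.
Proof.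
move=> a0 b0 t0 m_lt; exists (row_cons t a), (row_cons t b); split.
- exact/(forall_row_cons (> 0)).
- exact/(forall_row_cons (> 0)).
by rewrite map2_row_cons (Lp_mean_id lam01 p (ltW t0)) [ltLHS]elem_sym_row_cons.
Qed.

Lemma log_BM_fails_short_edge :
  log_BM_fails p lam n j.+1 -> log_BM_fails p lam n.+1 j.+1.
Proof.
move=> [a [b [a0 b0]]].
set m := map2_mx _ a b; set d := Lp_mean 0 _ _ _ => m_lt_d.
have [a_ge0 b_ge0] := (fun i => ltW (a0 i), fun i => ltW (b0 i)).
have m_ge0 k : 0 <= elem_sym m k by exact: elem_sym_Lp_mean_ge0.
pose t := (d - elem_sym m j.+1) / (1 + elem_sym m j).
have t0 : 0 < t by rewrite divr_gt0 ?subr_gt0// ltr_wpDr.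
apply: (log_BM_fails_row_cons a0 b0 t0); apply: (@lt_le_trans _ _ d).
  rewrite -ltrBrDl /t mulrAC ltr_pdivrMr ?ltr_wpDr// ltr_pM2l ?subr_gt0//.
  by rewrite ltrDr.
by apply: le_Lp_mean => //; rewrite elem_sym_ge0//= elem_sym_le_row_cons// ltW.
Qed.

Lemma log_BM_fails_long_edge :
  log_BM_fails p lam n j -> log_BM_fails p lam n.+1 j.+1.
Proof.
move=> [a [b [a0 b0]]].
set m := map2_mx _ a b; set d := Lp_mean 0 _ _ _ => m_lt_d.
have [a_ge0 b_ge0] := (fun i => ltW (a0 i), fun i => ltW (b0 i)).
have [ea0 eb0] := (elem_sym_ge0 j a_ge0, elem_sym_ge0 j b_ge0).
have m_ge0 k : 0 <= elem_sym m k by exact: elem_sym_Lp_mean_ge0.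
pose t := (1 + elem_sym m j.+1) / (d - elem_sym m j).
have t0 : 0 < t by rewrite divr_gt0 ?subr_gt0// ltr_wpDr.
apply: (log_BM_fails_row_cons a0 b0 t0); apply: (@lt_le_trans _ _ (t * d)).
  by rewrite -ltrBrDr -mulrBr divfK ?gt_eqF ?subr_gt0// ltrDr.
rewrite /d -(Lp_meanZ lam01 0 (ltW t0) ea0 eb0).
apply: le_Lp_mean => //; apply/andP; split.
- exact: mulr_ge0 (ltW t0) ea0.
- exact: mul_elem_sym_le_row_cons.
- exact: mulr_ge0 (ltW t0) eb0.
- exact: mul_elem_sym_le_row_cons.
Qed.

End CommonEdge.

Lemma log_BM_fails_lt p lam n j : 0 <= p < 1 -> 0 < lam < 1 ->
  (0 < j < n)%N -> log_BM_fails p lam n j.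
Proof.
move=> p01 lam01; elim: n j => [|n IHn] [|j] //=; rewrite ltnS leq_eqVlt.
move=> /predU1P[jn|jn]; last exact: log_BM_fails_short_edge (IHn j.+1 jn).
subst n; case: j => [|j] in IHn *; first exact: log_BM_fails_plane.
exact: log_BM_fails_long_edge (IHn j.+1 (ltnSn _)).
Qed.

End WidthVectors.

Theorem theorem1p1 (R : realType) (n j : nat) (p lam : R) :
  (3 <= n)%N -> (2 <= j <= n.-1)%N -> 0 <= p < 1 -> 0 < lam < 1 ->
  exists K L : set 'rV[R]_n,
    [/\ convex_body K, convex_body L, origin_symmetric K, origin_symmetric L &
       (
        intrinsic_volume (Lp_comb p lam K L) j
          < intrinsic_volume K j `^ (1 - lam) * intrinsic_volume L j `^ lam
      /\ intrinsic_volume K j `^ (1 - lam) * intrinsic_volume L j `^ lam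
          <= (if p == 0 then
                intrinsic_volume K j `^ (1 - lam) * intrinsic_volume L j `^ lam
              else
                ((1 - lam) * intrinsic_volume K j `^ (p / j%:R)
                 + lam * intrinsic_volume L j `^ (p / j%:R)) `^ (j%:R / p)))].
Proof.
move=> _ /andP[j2 jn] p01 lam01; have /andP[p0 p1] := p01.
have [j0 j_le_n jn0] : [/\ (0 < j)%N, (j <= n)%N & (0 < j < n)%N] by split; lia.
have [a [b [a0 b0 fails_ab]]] := log_BM_fails_lt p01 lam01 jn0.
have [a_ge0 b_ge0] := (fun i => ltW (a0 i), fun i => ltW (b0 i)).
exists (box a), (box b); split; [exact: convex_body_box|exact: convex_body_box|
  exact: origin_symmetric_box|exact: origin_symmetric_box|split].
- rewrite intrinsic_volume_Lp_comb_box ?p0 ?(ltW p1)// !intrinsic_volume_box//.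
  rewrite -Lp_mean0 (Lp_meanZ lam01)// ?elem_sym_ge0//.
  by rewrite ltr_pM2l ?exprn_gt0.
- case: eqVneq => // p_neq0.
  have pj0 : 0 < p / j%:R by rewrite divr_gt0 ?ltr0n// lt0r p_neq0.
  rewrite -Lp_mean0 -(invf_div p) -(Lp_mean_neq0 _ _ _ (lt0r_neq0 pj0)).
  apply: Lp_mean_homo_exp; rewrite ?lexx ?(ltW pj0)//;
    exact: intrinsic_volume_box_ge0.
Qed.
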